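(* Let $M_1,M_2$ be proof terms of $\mathbf{IPC}$. If $M_1\to M_2$ in $\mathbf{IPC}$ (one step of the compatible closure of the union of all reduction rules of $\mathbf{IPC}$), then $M_1^{\bullet}\to^+_{\beta\eta\varepsilon\epsilon\delta}M_2^{\bullet}$ and $M_1^{\bullet}\to^+_{\beta\eta\varrho\rho}M_2^{\bullet}$ in system $\mathbf{F}$; moreover, these reductions are fine in $\Gamma^{\bullet}$ whenever $M_1$ is typable in $\Gamma$. More precisely, in the first case: (1) for $R\in\{\beta_\supset,\eta_\supset,\beta_\wedge,\eta_\wedge\}$: if $M_1\to_R M_2$ in $\mathbf{IPC}$ then $M_1^\bullet\to_R M_2^\bullet$ in $\mathbf{F}$; (2) if $M_1\to_{\beta_\vee}M_2$ in $\mathbf{IPC}$ then $M_1^\bullet\to_\beta^+M_2^\bullet$ in $\mathbf{F}$; (3) if $M_1\to_{\eta_\vee}M_2$ in $\mathbf{IPC}$ then $M_1^\bullet\to_{\eta\delta}^+M_2^\bullet$ in $\mathbf{F}$; (4) for $R\in\{\pi_\supset,\pi_\wedge,\pi_\vee,\pi_\perp\}$: if $M_1\to_RM_2$ in $\mathbf{IPC}$ then $M_1^\bullet\to_{\varepsilon}^+M_2^\bullet$ in $\mathbf{F}$; (5) for $R\in\{\varpi_\supset,\varpi_\wedge,\varpi_\vee,\varpi_\perp\}$: if $M_1\to_RM_2$ in $\mathbf{IPC}$ then $M_1^\bullet\to_{\epsilon}^+M_2^\bullet$ in $\mathbf{F}$.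
   Context: **$\mathbf{IPC}$.** Types: $A,B,C::=X\mid\perp\mid A\supset B\mid A\wedge B\mid A\vee B$. Proof terms (raw, up to $\alpha$-equivalence): $x$, $\lambda x^A.M$, $MN$, $\langle M,N\rangle$, $M1$, $M2$ (projections), $\mathsf{in}_1(M,A,B)$, $\mathsf{in}_2(N,A,B)$, $\mathsf{case}(M,x^A.P,y^B.Q,C)$, $\mathsf{abort}(M,A)$. Typing is the usual natural deduction typing; $\mathsf{in}_i(M,A_1,A_2):A_1\vee A_2$ if $M:A_i$; $\Gamma\vdash\mathsf{case}(M,x^A.P,y^B.Q,C):C$ if $\Gamma\vdash M:A\vee B$, $\Gamma,x:A\vdash P:C$, $\Gamma,y:B\vdash Q:C$; $\mathsf{abort}(M,A):A$ if $M:\perp$. Reduction rules of $\mathbf{IPC}$ ($i\in\{1,2\}$; bound variables chosen to avoid capture): $\beta_\supset$: $(\lambda x^A.M)N\to[N/x]M$; $\beta_\wedge$: $\langle M_1,M_2\rangle i\to M_i$; $\beta_\vee$: $\mathsf{case}(\mathsf{in}_i(M,A_1,A_2),x_1^{A_1}.P_1,x_2^{A_2}.P_2,C)\to[M/x_i]P_i$; $\pi_\supset$: $\mathsf{case}(M,x.P,y.Q,C\supset D)N\to\mathsf{case}(M,x.PN,y.QN,D)$; $\pi_\wedge$: $\mathsf{case}(M,x.P,y.Q,C_1\wedge C_2)i\to\mathsf{case}(M,x.Pi,y.Qi,C_i)$; $\pi_\vee$: $\mathsf{case}(\mathsf{case}(M,x'.P',y'.Q',C\vee D),x^C.P,y^D.Q,E)\to\mathsf{case}(M,x'.\mathsf{case}(P',x^C.P,y^D.Q,E),y'.\mathsf{case}(Q',x^C.P,y^D.Q,E),E)$;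 $\pi_\perp$: $\mathsf{abort}(\mathsf{case}(M,x.P,y.Q,\perp),C)\to\mathsf{case}(M,x.\mathsf{abort}(P,C),y.\mathsf{abort}(Q,C),C)$; $\varpi_\supset$: $\mathsf{abort}(M,C\supset D)N\to\mathsf{abort}(M,D)$; $\varpi_\wedge$: $\mathsf{abort}(M,C_1\wedge C_2)i\to\mathsf{abort}(M,C_i)$; $\varpi_\vee$: $\mathsf{case}(\mathsf{abort}(M,C\vee D),x^C.P,y^D.Q,E)\to\mathsf{abort}(M,E)$; $\varpi_\perp$: $\mathsf{abort}(\mathsf{abort}(M,\perp),C)\to\mathsf{abort}(M,C)$; $\eta_\supset$: $\lambda x^A.Mx\to M$ ($x\notin M$); $\eta_\wedge$: $\langle M1,M2\rangle\to M$; $\eta_\vee$: $\mathsf{case}(M,x^A.\mathsf{in}_1(x,A,B),y^B.\mathsf{in}_2(y,A,B),A\vee B)\to M$. **System $\mathbf{F}$** (Church style, primitive conjunction). Types: $A,B::=X\mid A\supset B\mid A\wedge B\mid\forall X.A$. Terms (raw, not assumed typable, up to $\alpha$-equivalence): $x$, $\lambda x^A.M$, $MN$, $\langle M,N\rangle$, $M1$, $M2$, $\Lambda X.M$, $MB$ ($B$ a type). Application associates to the left; $\langle P_i\rangle_{i=1,2}$ is $\langle P_1,P_2\rangle$; $x\notin M$, $X\notin M$ mean ''not free in''. Environments $\Gamma$ are sets of declarations $x:A$, each variable declared at most once. Typing: usual rules for $\supset,\wedge$; $\forall I$: from $\Gamma\vdash M:A$ infer $\Gamma\vdash\Lambda X.M:\forall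 X.A$ if $X$ is free in no type of $\Gamma$; $\forall E$: from $\Gamma\vdash M:\forall X.A$ infer $\Gamma\vdash MB:[B/X]A$. ''$M$ has type $A$ in $\Gamma$'' means $\Gamma\vdash M:A$ is derivable; ''typable in $\Gamma$'' means it has some type in $\Gamma$. In $\mathbf{F}$, $\beta$ consists of $\beta_\supset$: $(\lambda x^A.M)N\to[N/x]M$, $\beta_\wedge$: $\langle M_1,M_2\rangle i\to M_i$ ($i\in\{1,2\}$), and $\beta_\forall$: $(\Lambda X.M)B\to[B/X]M$; $\eta$ consists of $\eta_\supset$: $\lambda x^A.Mx\to M$ ($x\notin M$), $\eta_\wedge$: $\langle M1,M2\rangle\to M$, and $\eta_\forall$: $\Lambda X.MX\to M$ ($X\notin M$). Abbreviations: $A\,\underline{\vee}\,B:=\forall X.((A\supset X)\wedge(B\supset X))\supset X$ ($X\notin A,B$), $\underline{\perp}:=\forall X.X$. **Extra conversions in $\mathbf{F}$** (bound variables of the contractum chosen fresh, so that no capture occurs). $\varrho$: $M(C_1\supset C_2)\langle\lambda x^A.P,\lambda y^B.Q\rangle\to\lambda z^{C_1}.MC_2\langle\lambda x^A.Pz,\lambda y^B.Qz\rangle$; $M(C_1\wedge C_2)\langle\lambda x^A.P,\lambda y^B.Q\rangle\to\langle MC_i\langle\lambda x^A.Pi,\lambda y^B.Qi\rangle\rangle_{i=1,2}$; $M(\forall Y.D)\langle\lambda x^A.P,\lambda y^B.Q\rangle\to\Lambda Y.MD\langle\lambda x^A.PY,\lambda y^B.QY\rangle$. $\rho$: $M(C_1\supset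 C_2)\to\lambda z^{C_1}.MC_2$; $M(C_1\wedge C_2)\to\langle MC_i\rangle_{i=1,2}$; $M(\forall Y.D)\to\Lambda Y.MD$. $\delta$: $M(C_1\supset C_2)\langle\lambda x^A\lambda z^{C_1}.P,\lambda y^B\lambda z^{C_1}.Q\rangle\to\lambda z^{C_1}.MC_2\langle\lambda x^A.P,\lambda y^B.Q\rangle$; $M(C_1\wedge C_2)\langle\lambda x^A.\langle P_i\rangle_{i=1,2},\lambda y^B.\langle Q_i\rangle_{i=1,2}\rangle\to\langle MC_i\langle\lambda x^A.P_i,\lambda y^B.Q_i\rangle\rangle_{i=1,2}$; $M(\forall Y.D)\langle\lambda x^A\Lambda Y.P,\lambda y^B\Lambda Y.Q\rangle\to\Lambda Y.MD\langle\lambda x^A.P,\lambda y^B.Q\rangle$. $\varepsilon$: $M(C_1\supset C_2)\langle\lambda x^A.P,\lambda y^B.Q\rangle N\to MC_2\langle\lambda x^A.PN,\lambda y^B.QN\rangle$; $M(C_1\wedge C_2)\langle\lambda x^A.P,\lambda y^B.Q\rangle i\to MC_i\langle\lambda x^A.Pi,\lambda y^B.Qi\rangle$; $M(\forall Y.C')\langle\lambda x^A.P,\lambda y^B.Q\rangle C''\to M([C''/Y]C')\langle\lambda x^A.PC'',\lambda y^B.QC''\rangle$. $\epsilon$: $M(C_1\supset C_2)N\to MC_2$; $M(C_1\wedge C_2)i\to MC_i$; $M(\forall Y.C')C''\to M([C''/Y]C')$. For a set $R$ of rules (juxtaposition means union), $\to_R$ is the compatible closure of $R$ and $\to_R^+$,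 $\to_R^*$ its transitive and reflexive-transitive closures. **Fineness.** A root $\beta$- or $\eta$-reduction is fine in every environment. A root $\varrho$-, $\delta$- or $\varepsilon$-reduction, whose redex consists of a head term $M$ applied to a type $C$ and then to a pair of the form $\langle\lambda x^A.P,\lambda y^B.Q\rangle$ (followed, in the case of $\varepsilon$, by one further elimination), is fine in $\Gamma$ if $M$ has type $A\,\underline{\vee}\,B$ in $\Gamma$; a root $\rho$- or $\epsilon$-reduction, whose redex consists of a head term $M$ applied to a type $C$ (followed, in the case of $\epsilon$, by one further elimination), is fine in $\Gamma$ if $M$ has type $\underline{\perp}$ in $\Gamma$. ''$M\to_RM'$ is fine in $\Gamma$'' is the ternary relation inductively generated from the fine root $R$-reductions by: if $M\to M'$ is fine in $x:A,\Gamma$ then $\lambda x^A.M\to\lambda x^A.M'$ is fine in $\Gamma$; and, if $M\to M'$ is fine in $\Gamma$, then so are $MN\to M'N$, $NM\to NM'$, $\langle M,N\rangle\to\langle M',N\rangle$, $\langle N,M\rangle\to\langle N,M'\rangle$, $Mi\to M'i$, $\Lambda X.M\to\Lambda X.M'$, $MB\to M'B$. ''$M\to_R^+M'$ (resp. $\to_R^*$) is fine in $\Gamma$'' is the transitive (resp. reflexive-transitive) closure for fixed $\Gamma$. **Russell-Prawitz translation.** On types: $X^\bullet=X$, $\perp^\bullet=\underline{\perp}$, $(A\supset B)^\bullet=A^\bullet\supset B^\bullet$, $(A\wedge B)^\bullet=A^\bullet\wedge B^\bullet$, $(A\vee B)^\bullet=A^\bullet\,\underline{\vee}\,B^\bullet$.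 On terms it is homomorphic on variables, $\lambda$ (with $(\lambda x^A.M)^\bullet=\lambda x^{A^\bullet}.M^\bullet$), application, pairs and projections, and $(\mathsf{in}_i(M,A,B))^\bullet=\Lambda X.\lambda w^{(A^\bullet\supset X)\wedge(B^\bullet\supset X)}.(w\,i)M^\bullet$ ($X$, $w$ fresh), $(\mathsf{case}(M,x^A.P,y^B.Q,C))^\bullet=M^\bullet C^\bullet\langle\lambda x^{A^\bullet}.P^\bullet,\lambda y^{B^\bullet}.Q^\bullet\rangle$, $(\mathsf{abort}(M,A))^\bullet=M^\bullet A^\bullet$. $\Gamma^\bullet$ is obtained by translating all types in $\Gamma$. *)

(* Defs.v *)
(* Plain Stdlib development.  Terms and types are taken up to alpha-equivalence
   by means of de Bruijn indices; in the terms of F, type variables and term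
   variables are indexed separately (a type binder does not count for term
   indices, and conversely).  Names x y z in the comments are those of the
   usual named presentation. *)
From Stdlib Require Export List Relations.
Export ListNotations.

(* Extends a renaming or substitution with a value for index 0. *)
Definition scons {T : Type} (t : T) (s : nat -> T) (n : nat) : T :=
  match n with 0 => t | S m => s m end.

Definition upr (r : nat -> nat) : nat -> nat := scons 0 (fun n => S (r n)).

Definition swap (n : nat) : nat :=
  match n with 0 => 1 | 1 => 0 | _ => n end.

(* The index i of a projection or injection. *)
Inductive side : Type := one | two.

Definition sel {T : Type} (i : side) (a b : T) : T :=
  match i with one => a | two => b end.

(** * IPC *)

Inductive ity : Type :=
| ITvar (n : nat)
| IBot
| IImp (A B : ity)
| IAnd (A B : ity)
| IOr (A B : ity).

(* ILam and each branch of ICase bind one variable. *)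
Inductive iterm : Type :=
| IVar (n : nat)
| ILam (A : ity) (M : iterm)
| IApp (M N : iterm)
| IPair (M N : iterm)
| IProj (M : iterm) (i : side)
| IIn (i : side) (M : iterm) (A B : ity)
| ICase (M : iterm) (A : ity) (P : iterm) (B : ity) (Q : iterm) (C : ity)
| IAbort (M : iterm) (A : ity).

Fixpoint iren (r : nat -> nat) (M : iterm) : iterm :=
  match M with
  | IVar n => IVar (r n)
  | ILam A M => ILam A (iren (upr r) M)
  | IApp M N => IApp (iren r M) (iren r N)
  | IPair M N => IPair (iren r M) (iren r N)
  | IProj M i => IProj (iren r M) i
  | IIn i M A B => IIn i (iren r M) A B
  | ICase M A P B Q C =>
      ICase (iren r M) A (iren (upr r) P) B (iren (upr r) Q) C
  | IAbort M A => IAbort (iren r M) A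
  end.

Definition iup (s : nat -> iterm) : nat -> iterm :=
  scons (IVar 0) (fun n => iren S (s n)).

Fixpoint isubst (s : nat -> iterm) (M : iterm) : iterm :=
  match M with
  | IVar n => s n
  | ILam A M => ILam A (isubst (iup s) M)
  | IApp M N => IApp (isubst s M) (isubst s N)
  | IPair M N => IPair (isubst s M) (isubst s N)
  | IProj M i => IProj (isubst s M) i
  | IIn i M A B => IIn i (isubst s M) A B
  | ICase M A P B Q C =>
      ICase (isubst s M) A (isubst (iup s) P) B (isubst (iup s) Q) C
  | IAbort M A => IAbort (isubst s M) A
  end.

Definition isubst1 (N M : iterm) : iterm := isubst (scons N IVar) M.

Inductive ihas_type : list ity -> iterm -> ity -> Prop :=
| IT_Var G n A : nth_error G n = Some A -> ihas_type G (IVar n) A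
| IT_Lam G A B M : ihas_type (A :: G) M B -> ihas_type G (ILam A M) (IImp A B)
| IT_App G A B M N :
    ihas_type G M (IImp A B) -> ihas_type G N A -> ihas_type G (IApp M N) B
| IT_Pair G A B M N :
    ihas_type G M A -> ihas_type G N B -> ihas_type G (IPair M N) (IAnd A B)
| IT_Proj G A B M i :
    ihas_type G M (IAnd A B) -> ihas_type G (IProj M i) (sel i A B)
| IT_In G A B M i :
    ihas_type G M (sel i A B) -> ihas_type G (IIn i M A B) (IOr A B)
| IT_Case G A B C M P Q :
    ihas_type G M (IOr A B) ->
    ihas_type (A :: G) P C -> ihas_type (B :: G) Q C ->
    ihas_type G (ICase M A P B Q C) C
| IT_Abort G A M : ihas_type G M IBot -> ihas_type G (IAbort M A) A.

Definition itypable (G : list ity) (M : iterm) : Prop :=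
  exists A, ihas_type G M A.

Inductive irule : Type :=
| ibeta_imp | ibeta_and | ibeta_or
| ipi_imp | ipi_and | ipi_or | ipi_bot
| ivarpi_imp | ivarpi_and | ivarpi_or | ivarpi_bot
| ieta_imp | ieta_and | ieta_or.

Definition irules : list irule :=
  [ibeta_imp; ibeta_and; ibeta_or;
   ipi_imp; ipi_and; ipi_or; ipi_bot;
   ivarpi_imp; ivarpi_and; ivarpi_or; ivarpi_bot;
   ieta_imp; ieta_and; ieta_or].

Inductive iroot : irule -> iterm -> iterm -> Prop :=
| Ibeta_imp A M N : iroot ibeta_imp (IApp (ILam A M) N) (isubst1 N M)
| Ibeta_and M1 M2 i : iroot ibeta_and (IProj (IPair M1 M2) i) (sel i M1 M2)
| Ibeta_or i M A1 A2 P1 P2 C :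
    iroot ibeta_or (ICase (IIn i M A1 A2) A1 P1 A2 P2 C)
                   (isubst1 M (sel i P1 P2))
| Ipi_imp M A P B Q C D N :
    iroot ipi_imp
      (IApp (ICase M A P B Q (IImp C D)) N)
      (ICase M A (IApp P (iren S N)) B (IApp Q (iren S N)) D)
| Ipi_and M A P B Q C1 C2 i :
    iroot ipi_and
      (IProj (ICase M A P B Q (IAnd C1 C2)) i)
      (ICase M A (IProj P i) B (IProj Q i) (sel i C1 C2))
| Ipi_or M A' P' B' Q' C D P Q E :
    iroot ipi_or
      (ICase (ICase M A' P' B' Q' (IOr C D)) C P D Q E)
      (ICase M
         A' (ICase P' C (iren (upr S) P) D (iren (upr S) Q) E)
         B' (ICase Q' C (iren (upr S) P) D (iren (upr S) Q) E)
         E)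
| Ipi_bot M A P B Q C :
    iroot ipi_bot
      (IAbort (ICase M A P B Q IBot) C)
      (ICase M A (IAbort P C) B (IAbort Q C) C)
| Ivarpi_imp M C D N :
    iroot ivarpi_imp (IApp (IAbort M (IImp C D)) N) (IAbort M D)
| Ivarpi_and M C1 C2 i :
    iroot ivarpi_and (IProj (IAbort M (IAnd C1 C2)) i) (IAbort M (sel i C1 C2))
| Ivarpi_or M C D P Q E :
    iroot ivarpi_or (ICase (IAbort M (IOr C D)) C P D Q E) (IAbort M E)
| Ivarpi_bot M C :
    iroot ivarpi_bot (IAbort (IAbort M IBot) C) (IAbort M C)
| Ieta_imp A M : iroot ieta_imp (ILam A (IApp (iren S M) (IVar 0))) M
| Ieta_and M : iroot ieta_and (IPair (IProj M one) (IProj M two)) M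
| Ieta_or M A B :
    iroot ieta_or
      (ICase M A (IIn one (IVar 0) A B) B (IIn two (IVar 0) A B) (IOr A B)) M.

Inductive istep (R : list irule) : iterm -> iterm -> Prop :=
| Is_root r M M' : In r R -> iroot r M M' -> istep R M M'
| Is_lam A M M' : istep R M M' -> istep R (ILam A M) (ILam A M')
| Is_app1 M M' N : istep R M M' -> istep R (IApp M N) (IApp M' N)
| Is_app2 M N N' : istep R N N' -> istep R (IApp M N) (IApp M N')
| Is_pair1 M M' N : istep R M M' -> istep R (IPair M N) (IPair M' N)
| Is_pair2 M N N' : istep R N N' -> istep R (IPair M N) (IPair M N')
| Is_proj M M' i : istep R M M' -> istep R (IProj M i) (IProj M' i)
| Is_in i M M' A B : istep R M M' -> istep R (IIn i M A B) (IIn i M' A B)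
| Is_case1 M M' A P B Q C :
    istep R M M' -> istep R (ICase M A P B Q C) (ICase M' A P B Q C)
| Is_case2 M A P P' B Q C :
    istep R P P' -> istep R (ICase M A P B Q C) (ICase M A P' B Q C)
| Is_case3 M A P B Q Q' C :
    istep R Q Q' -> istep R (ICase M A P B Q C) (ICase M A P B Q' C)
| Is_abort M M' A : istep R M M' -> istep R (IAbort M A) (IAbort M' A).

(** * System F *)

Inductive ty : Type :=
| Tvar (n : nat)
| Imp (A B : ty)
| And (A B : ty)
| All (A : ty).

Fixpoint tyren (r : nat -> nat) (A : ty) : ty :=
  match A with
  | Tvar n => Tvar (r n)
  | Imp A B => Imp (tyren r A) (tyren r B)
  | And A B => And (tyren r A) (tyren r B)
  | All A => All (tyren (upr r) A)
  end.

Definition tyup (s : nat -> ty) : nat -> ty :=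
  scons (Tvar 0) (fun n => tyren S (s n)).

Fixpoint tysubst (s : nat -> ty) (A : ty) : ty :=
  match A with
  | Tvar n => s n
  | Imp A B => Imp (tysubst s A) (tysubst s B)
  | And A B => And (tysubst s A) (tysubst s B)
  | All A => All (tysubst (tyup s) A)
  end.

Definition tysubst1 (B A : ty) : ty := tysubst (scons B Tvar) A.

(* Lam binds a term variable, TLam a type variable. *)
Inductive term : Type :=
| Var (n : nat)
| Lam (A : ty) (M : term)
| App (M N : term)
| Pair (M N : term)
| Proj (M : term) (i : side)
| TLam (M : term)
| TApp (M : term) (B : ty).

(* q acts on type variables, r on term variables. *)
Fixpoint ren (q r : nat -> nat) (M : term) : term :=
  match M with
  | Var n => Var (r n)
  | Lam A M => Lam (tyren q A) (ren q (upr r) M)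
  | App M N => App (ren q r M) (ren q r N)
  | Pair M N => Pair (ren q r M) (ren q r N)
  | Proj M i => Proj (ren q r M) i
  | TLam M => TLam (ren (upr q) r M)
  | TApp M B => TApp (ren q r M) (tyren q B)
  end.

Definition idr (n : nat) : nat := n.

Definition shift : term -> term := ren idr S.
Definition tshift : term -> term := ren S idr.

Fixpoint subst (t : nat -> ty) (s : nat -> term) (M : term) : term :=
  match M with
  | Var n => s n
  | Lam A M => Lam (tysubst t A) (subst t (scons (Var 0) (fun n => shift (s n))) M)
  | App M N => App (subst t s M) (subst t s N)
  | Pair M N => Pair (subst t s M) (subst t s N)
  | Proj M i => Proj (subst t s M) i
  | TLam M => TLam (subst (tyup t) (fun n => tshift (s n)) M)
  | TApp M B => TApp (subst t s M) (tysubst t B)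
  end.

Definition subst1 (N M : term) : term := subst Tvar (scons N Var) M.
Definition tsubst1 (B : ty) (M : term) : term := subst (scons B Tvar) Var M.

Inductive has_type : list ty -> term -> ty -> Prop :=
| T_Var G n A : nth_error G n = Some A -> has_type G (Var n) A
| T_Lam G A B M : has_type (A :: G) M B -> has_type G (Lam A M) (Imp A B)
| T_App G A B M N :
    has_type G M (Imp A B) -> has_type G N A -> has_type G (App M N) B
| T_Pair G A B M N :
    has_type G M A -> has_type G N B -> has_type G (Pair M N) (And A B)
| T_Proj G A B M i : has_type G M (And A B) -> has_type G (Proj M i) (sel i A B)
| T_TLam G A M : has_type (map (tyren S) G) M A -> has_type G (TLam M) (All A)
| T_TApp G A B M : has_type G M (All A) -> has_type G (TApp M B) (tysubst1 B A).

Definition Or (A B : ty) : ty :=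
  All (Imp (And (Imp (tyren S A) (Tvar 0)) (Imp (tyren S B) (Tvar 0))) (Tvar 0)).

Definition Bot : ty := All (Tvar 0).

(* varepsilon is the rule with head of disjunctive type, epsilon the one with
   head of absurd type; likewise varrho and rho. *)
Inductive rule : Type :=
| beta_imp | beta_and | beta_all
| eta_imp | eta_and | eta_all
| varrho | rho | delta | varepsilon | epsilon.

Definition beta : list rule := [beta_imp; beta_and; beta_all].
Definition eta : list rule := [eta_imp; eta_and; eta_all].

(* The common part  M C <\x^A.P, \y^B.Q>  of varrho-, delta- and
   varepsilon-redexes and contracta. *)
Definition ccase (M : term) (C : ty) (A : ty) (P : term) (B : ty) (Q : term)
  : term := App (TApp M C) (Pair (Lam A P) (Lam B Q)).

Inductive root : rule -> term -> term -> Prop :=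
| R_beta_imp A M N : root beta_imp (App (Lam A M) N) (subst1 N M)
| R_beta_and M1 M2 i : root beta_and (Proj (Pair M1 M2) i) (sel i M1 M2)
| R_beta_all M B : root beta_all (TApp (TLam M) B) (tsubst1 B M)
| R_eta_imp A M : root eta_imp (Lam A (App (shift M) (Var 0))) M
| R_eta_and M : root eta_and (Pair (Proj M one) (Proj M two)) M
| R_eta_all M : root eta_all (TLam (TApp (tshift M) (Tvar 0))) M
(* In the contractum, z is bound outside x and y: below both, x and y have
   index 0 and z has index 1. *)
| R_varrho_imp M C1 C2 A P B Q :
    root varrho
      (ccase M (Imp C1 C2) A P B Q)
      (Lam C1 (ccase (shift M) C2
                 A (App (ren idr (upr S) P) (Var 1))
                 B (App (ren idr (upr S) Q) (Var 1))))
| R_varrho_and M C1 C2 A P B Q :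
    root varrho
      (ccase M (And C1 C2) A P B Q)
      (Pair (ccase M C1 A (Proj P one) B (Proj Q one))
            (ccase M C2 A (Proj P two) B (Proj Q two)))
| R_varrho_all M D A P B Q :
    root varrho
      (ccase M (All D) A P B Q)
      (TLam (ccase (tshift M) D
               (tyren S A) (TApp (tshift P) (Tvar 0))
               (tyren S B) (TApp (tshift Q) (Tvar 0))))
| R_rho_imp M C1 C2 :
    root rho (TApp M (Imp C1 C2)) (Lam C1 (TApp (shift M) C2))
| R_rho_and M C1 C2 :
    root rho (TApp M (And C1 C2)) (Pair (TApp M C1) (TApp M C2))
| R_rho_all M D :
    root rho (TApp M (All D)) (TLam (TApp (tshift M) D))
(* The binders of x (or y) and z are exchanged, hence swap. *)
| R_delta_imp M C1 C2 A P B Q :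
    root delta
      (ccase M (Imp C1 C2) A (Lam C1 P) B (Lam C1 Q))
      (Lam C1 (ccase (shift M) C2 A (ren idr swap P) B (ren idr swap Q)))
| R_delta_and M C1 C2 A P1 P2 B Q1 Q2 :
    root delta
      (ccase M (And C1 C2) A (Pair P1 P2) B (Pair Q1 Q2))
      (Pair (ccase M C1 A P1 B Q1) (ccase M C2 A P2 B Q2))
| R_delta_all M D A P B Q :
    root delta
      (ccase M (All D) A (TLam P) B (TLam Q))
      (TLam (ccase (tshift M) D (tyren S A) P (tyren S B) Q))
| R_varepsilon_imp M C1 C2 A P B Q N :
    root varepsilon
      (App (ccase M (Imp C1 C2) A P B Q) N)
      (ccase M C2 A (App P (shift N)) B (App Q (shift N)))
| R_varepsilon_and M C1 C2 A P B Q i :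
    root varepsilon
      (Proj (ccase M (And C1 C2) A P B Q) i)
      (ccase M (sel i C1 C2) A (Proj P i) B (Proj Q i))
| R_varepsilon_all M C' A P B Q C'' :
    root varepsilon
      (TApp (ccase M (All C') A P B Q) C'')
      (ccase M (tysubst1 C'' C') A (TApp P C'') B (TApp Q C''))
| R_epsilon_imp M C1 C2 N :
    root epsilon (App (TApp M (Imp C1 C2)) N) (TApp M C2)
| R_epsilon_and M C1 C2 i :
    root epsilon (Proj (TApp M (And C1 C2)) i) (TApp M (sel i C1 C2))
| R_epsilon_all M C' C'' :
    root epsilon (TApp (TApp M (All C')) C'') (TApp M (tysubst1 C'' C')).

Inductive step (R : list rule) : term -> term -> Prop :=
| S_root r M M' : In r R -> root r M M' -> step R M M'
| S_lam A M M' : step R M M' -> step R (Lam A M) (Lam A M')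
| S_app1 M M' N : step R M M' -> step R (App M N) (App M' N)
| S_app2 M N N' : step R N N' -> step R (App M N) (App M N')
| S_pair1 M M' N : step R M M' -> step R (Pair M N) (Pair M' N)
| S_pair2 M N N' : step R N N' -> step R (Pair M N) (Pair M N')
| S_proj M M' i : step R M M' -> step R (Proj M i) (Proj M' i)
| S_tlam M M' : step R M M' -> step R (TLam M) (TLam M')
| S_tapp M M' B : step R M M' -> step R (TApp M B) (TApp M' B).

Definition steps (R : list rule) : term -> term -> Prop :=
  clos_trans term (step R).

(** * Fineness *)

Inductive elim : Type :=
| Eapp (N : term)
| Eproj (i : side)
| Etapp (B : ty).

Definition eliminate (M : term) (e : elim) : term :=
  match e with
  | Eapp N => App M N
  | Eproj i => Proj M i
  | Etapp B => TApp M B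
  end.

Inductive fine_root (G : list ty) : rule -> term -> term -> Prop :=
| FR_beta_eta r M M' : In r (beta ++ eta) -> root r M M' -> fine_root G r M M'
| FR_varrho_delta r M C A P B Q M' :
    In r [varrho; delta] -> has_type G M (Or A B) ->
    root r (ccase M C A P B Q) M' ->
    fine_root G r (ccase M C A P B Q) M'
| FR_varepsilon M C A P B Q e M' :
    has_type G M (Or A B) ->
    root varepsilon (eliminate (ccase M C A P B Q) e) M' ->
    fine_root G varepsilon (eliminate (ccase M C A P B Q) e) M'
| FR_rho M C M' :
    has_type G M Bot -> root rho (TApp M C) M' -> fine_root G rho (TApp M C) M'
| FR_epsilon M C e M' :
    has_type G M Bot -> root epsilon (eliminate (TApp M C) e) M' ->
    fine_root G epsilon (eliminate (TApp M C) e) M'.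

(* In FS_tlam the bound type variable is fresh for the environment, which is
   therefore shifted, as in T_TLam. *)
Inductive fine_step (R : list rule) : list ty -> term -> term -> Prop :=
| FS_root G r M M' : In r R -> fine_root G r M M' -> fine_step R G M M'
| FS_lam G A M M' :
    fine_step R (A :: G) M M' -> fine_step R G (Lam A M) (Lam A M')
| FS_app1 G M M' N : fine_step R G M M' -> fine_step R G (App M N) (App M' N)
| FS_app2 G M N N' : fine_step R G N N' -> fine_step R G (App M N) (App M N')
| FS_pair1 G M M' N : fine_step R G M M' -> fine_step R G (Pair M N) (Pair M' N)
| FS_pair2 G M N N' : fine_step R G N N' -> fine_step R G (Pair M N) (Pair M N')
| FS_proj G M M' i : fine_step R G M M' -> fine_step R G (Proj M i) (Proj M' i)
| FS_tlam G M M' :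
    fine_step R (map (tyren S) G) M M' -> fine_step R G (TLam M) (TLam M')
| FS_tapp G M M' B : fine_step R G M M' -> fine_step R G (TApp M B) (TApp M' B).

Definition fine_steps (R : list rule) (G : list ty) : term -> term -> Prop :=
  clos_trans term (fine_step R G).

(** * Russell-Prawitz translation *)

Fixpoint rpty (A : ity) : ty :=
  match A with
  | ITvar n => Tvar n
  | IBot => Bot
  | IImp A B => Imp (rpty A) (rpty B)
  | IAnd A B => And (rpty A) (rpty B)
  | IOr A B => Or (rpty A) (rpty B)
  end.

(* In the clause of IIn, ren S S moves the translated subterm below the binders
   of X and w. *)
Fixpoint rp (M : iterm) : term :=
  match M with
  | IVar n => Var n
  | ILam A M => Lam (rpty A) (rp M)
  | IApp M N => App (rp M) (rp N)
  | IPair M N => Pair (rp M) (rp N)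
  | IProj M i => Proj (rp M) i
  | IIn i M A B =>
      TLam (Lam (And (Imp (tyren S (rpty A)) (Tvar 0))
                     (Imp (tyren S (rpty B)) (Tvar 0)))
              (App (Proj (Var 0) i) (ren S S (rp M))))
  | ICase M A P B Q C =>
      App (TApp (rp M) (rpty C)) (Pair (Lam (rpty A) (rp P)) (Lam (rpty B) (rp Q)))
  | IAbort M A => TApp (rp M) (rpty A)
  end.

Definition rpctx (G : list ity) : list ty := map rpty G.

(* Main.v *)
Require Import Defs.

(* Every root reduction of IPC is translated into a short explicit chain in F
   ending exactly in the translation of the contractum; since a translated
   case or abort has a head of type Or or Bot as soon as the source is typable,
   all steps of the chain are fine.  The only binder that has no counterpart in
   IPC is the one of rp (IIn _ _ _ _), which places the translation of the
   subterm below a type and a term binder: this is why reduction and typing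
   must be shown stable under renaming.

   The reduction with varrho and rho follows from the one with varepsilon,
   epsilon and delta: an epsilon-step is a rho-step creating a beta-redex with
   the eliminator, a varepsilon-step is likewise varrho followed by beta, and
   delta is varrho followed by beta in both branches. *)

(** * Renaming and substitution in the types of F *)

Ltac index_cases := let n := fresh "n" in intros [|n]; try reflexivity.

Lemma tyren_ext q q' A : (forall n, q n = q' n) -> tyren q A = tyren q' A.
Proof.
  revert q q'; induction A; intros q q' E; cbn; f_equal; auto.
  apply IHA; index_cases; cbn; auto.
Qed.

Lemma tyren_id q A : (forall n, q n = n) -> tyren q A = A.
Proof.
  revert q; induction A; intros q E; cbn; f_equal; auto.
  apply IHA; index_cases; cbn; auto.
Qed.

Lemma tyren_tyren q q' A : tyren q (tyren q' A) = tyren (fun n => q (q' n)) A.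
Proof.
  revert q q'; induction A; intros q q'; cbn; f_equal; auto.
  rewrite IHA; apply tyren_ext; index_cases.
Qed.

Lemma tysubst_ext t t' A : (forall n, t n = t' n) -> tysubst t A = tysubst t' A.
Proof.
  revert t t'; induction A; intros t t' E; cbn; f_equal; auto.
  apply IHA; index_cases; cbn; now rewrite E.
Qed.

Lemma tysubst_id t A : (forall n, t n = Tvar n) -> tysubst t A = A.
Proof.
  revert t; induction A; intros t E; cbn; f_equal; auto.
  apply IHA; index_cases; cbn; now rewrite E.
Qed.

Lemma tysubst_tyren t q A : tysubst t (tyren q A) = tysubst (fun n => t (q n)) A.
Proof.
  revert t q; induction A; intros t q; cbn; f_equal; auto.
  rewrite IHA; apply tysubst_ext; index_cases.
Qed.

Lemma tyren_upr_shift q A : tyren (upr q) (tyren S A) = tyren S (tyren q A).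
Proof. now rewrite !tyren_tyren. Qed.

Lemma tyren_tysubst q t A :
  tyren q (tysubst t A) = tysubst (fun n => tyren q (t n)) A.
Proof.
  revert q t; induction A; intros q t; cbn; f_equal; auto.
  rewrite IHA; apply tysubst_ext; index_cases; apply tyren_upr_shift.
Qed.

Lemma tyren_tysubst1 q B A :
  tyren q (tysubst1 B A) = tysubst1 (tyren q B) (tyren (upr q) A).
Proof.
  unfold tysubst1; rewrite tyren_tysubst, tysubst_tyren.
  apply tysubst_ext; index_cases.
Qed.

Lemma tysubst1_shift B A : tysubst1 B (tyren S A) = A.
Proof. unfold tysubst1; rewrite tysubst_tyren; now apply tysubst_id. Qed.

Lemma tyren_Or q A B : tyren q (Or A B) = Or (tyren q A) (tyren q B).
Proof. unfold Or; cbn; now rewrite !tyren_upr_shift. Qed.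

(** The left-hand side is the body of [Or A B] instantiated at [C], that is, the type of a
    disjunctive head applied to [C]. Seeing it as an implication types the translated case and lets
    a rule for [Imp] fire after one for [All]. *)
Lemma tysubst1_Or C A B :
  tysubst1 C (Imp (And (Imp (tyren S A) (Tvar 0)) (Imp (tyren S B) (Tvar 0)))
                  (Tvar 0))
  = Imp (And (Imp A C) (Imp B C)) C.
Proof.
  transitivity (Imp (And (Imp (tysubst1 C (tyren S A)) C)
                         (Imp (tysubst1 C (tyren S B)) C)) C); [reflexivity|].
  now rewrite !tysubst1_shift.
Qed.

Lemma tyren_sel q i A B : tyren q (sel i A B) = sel i (tyren q A) (tyren q B).
Proof. now destruct i. Qed.

(** * Renaming and substitution in the terms of F *)

Lemma ren_ext q q' r r' M :
  (forall n, q n = q' n) -> (forall n, r n = r' n) -> ren q r M = ren q' r' M.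
Proof.
  revert q q' r r'; induction M; intros q q' r r' Eq Er; cbn; f_equal;
    auto using tyren_ext; apply IHM; auto; index_cases; cbn; auto.
Qed.

Lemma ren_ren q q' r r' M :
  ren q r (ren q' r' M) = ren (fun n => q (q' n)) (fun n => r (r' n)) M.
Proof.
  revert q q' r r'; induction M; intros q q' r r'; cbn; f_equal;
    auto using tyren_tyren; rewrite IHM; apply ren_ext; auto; index_cases.
Qed.

Lemma subst_ext t t' s s' M :
  (forall n, t n = t' n) -> (forall n, s n = s' n) ->
  subst t s M = subst t' s' M.
Proof.
  revert t t' s s'; induction M; intros t t' s s' Et Es; cbn; f_equal;
    auto using tysubst_ext; apply IHM; auto; try index_cases; cbn;
    intros; congruence.
Qed.

Lemma subst_id t s M :
  (forall n, t n = Tvar n) -> (forall n, s n = Var n) -> subst t s M = M.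
Proof.
  revert t s; induction M; intros t s Et Es; cbn; f_equal;
    auto using tysubst_id; apply IHM; auto; try index_cases; cbn; intros;
    rewrite ?Et, ?Es; reflexivity.
Qed.

Lemma subst_ren t s q r M :
  subst t s (ren q r M) = subst (fun n => t (q n)) (fun n => s (r n)) M.
Proof.
  revert t s q r; induction M; intros t s q r; cbn; f_equal;
    auto using tysubst_tyren; rewrite IHM; apply subst_ext; auto; index_cases.
Qed.

Lemma tysubst_as_tyren t q A :
  (forall n, t n = Tvar (q n)) -> tysubst t A = tyren q A.
Proof.
  revert t q; induction A; intros t q E; cbn; auto; f_equal; auto.
  apply IHA; index_cases; cbn; now rewrite E.
Qed.

(** Used when a contraction only moves indices: a type binder disappears in [root_beta_or], a
    variable replaces another in [delta_by_varrho]. *)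
Lemma subst_as_ren t s q r M :
  (forall n, t n = Tvar (q n)) -> (forall n, s n = Var (r n)) ->
  subst t s M = ren q r M.
Proof.
  revert t s q r; induction M; intros t s q r Et Es; cbn; auto; f_equal;
    auto using tysubst_as_tyren; apply IHM; auto; try index_cases; cbn; intros;
    rewrite ?Et, ?Es; reflexivity.
Qed.

Lemma ren_shift q r M : ren q (upr r) (shift M) = shift (ren q r M).
Proof. unfold shift; now rewrite !ren_ren. Qed.

Lemma ren_tshift q r M : ren (upr q) r (tshift M) = tshift (ren q r M).
Proof. unfold tshift; now rewrite !ren_ren. Qed.

Lemma ren_subst q r t s M :
  ren q r (subst t s M)
  = subst (fun n => tyren q (t n)) (fun n => ren q r (s n)) M.
Proof.
  revert q r t s; induction M; intros q r t s; cbn; f_equal;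
    auto using tyren_tysubst; rewrite IHM; apply subst_ext; auto; try index_cases;
    cbn; auto using tyren_upr_shift, ren_shift, ren_tshift.
Qed.

Lemma ren_subst1 q r N M :
  ren q r (subst1 N M) = subst1 (ren q r N) (ren q (upr r) M).
Proof.
  unfold subst1; rewrite ren_subst, subst_ren.
  apply subst_ext; auto; index_cases.
Qed.

Lemma ren_tsubst1 q r B M :
  ren q r (tsubst1 B M) = tsubst1 (tyren q B) (ren (upr q) r M).
Proof.
  unfold tsubst1; rewrite ren_subst, subst_ren.
  apply subst_ext; auto; index_cases.
Qed.

Lemma subst1_shift N M : subst1 N (shift M) = M.
Proof. unfold subst1, shift; rewrite subst_ren; now apply subst_id. Qed.

Lemma tsubst1_tshift B M : tsubst1 B (tshift M) = M.
Proof. unfold tsubst1, tshift; rewrite subst_ren; now apply subst_id. Qed.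

(** [ren idr (upr S)] makes room for z just outside x. This lemma and [ren_swap] let renaming pass
    through the contracta of [varrho] and [delta] at an implication. *)
Lemma ren_upr_shift q r M :
  ren q (upr (upr r)) (ren idr (upr S) M) = ren idr (upr S) (ren q (upr r) M).
Proof. rewrite !ren_ren; apply ren_ext; auto; index_cases. Qed.

Lemma ren_swap q r M :
  ren q (upr (upr r)) (ren idr swap M) = ren idr swap (ren q (upr (upr r)) M).
Proof. rewrite !ren_ren; apply ren_ext; auto; intros [|[|n]]; reflexivity. Qed.

Lemma ren_sel q r i M N : ren q r (sel i M N) = sel i (ren q r M) (ren q r N).
Proof. now destruct i. Qed.

(** * Typing, reduction and fineness under renaming *)

Definition ren_ok (q r : nat -> nat) (G G' : list ty) : Prop :=
  forall n A, nth_error G n = Some A -> nth_error G' (r n) = Some (tyren q A).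

Lemma ren_ok_cons q r G G' A :
  ren_ok q r G G' -> ren_ok q (upr r) (A :: G) (tyren q A :: G').
Proof. intros E [|n] B; cbn; [now intros [= ->]|apply E]. Qed.

Lemma ren_ok_shift q r G G' :
  ren_ok q r G G' -> ren_ok (upr q) r (map (tyren S) G) (map (tyren S) G').
Proof.
  intros E n B; rewrite !nth_error_map.
  destruct (nth_error G n) as [A|] eqn:EA; cbn; [|discriminate].
  intros [= <-]; rewrite (E _ _ EA); cbn; now rewrite tyren_upr_shift.
Qed.

Lemma ren_ok_tshift G : ren_ok S idr G (map (tyren S) G).
Proof. intros n A E; unfold idr; now rewrite nth_error_map, E. Qed.

Lemma ren_ok_weaken A G : ren_ok S S G (A :: map (tyren S) G).
Proof. intros n B E; cbn; now rewrite nth_error_map, E. Qed.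

(** Type and term indices are renamed together, so that one induction covers weakening by a type
    variable, by a term variable, and by both as below an injection. *)
Lemma has_type_ren G M A q r G' :
  has_type G M A -> ren_ok q r G G' -> has_type G' (ren q r M) (tyren q A).
Proof.
  intros D; revert q r G'; induction D; intros q r G' E; cbn.
  - constructor; auto.
  - constructor; auto using ren_ok_cons.
  - econstructor; [apply IHD1|apply IHD2]; auto.
  - constructor; auto.
  - rewrite tyren_sel; constructor; now apply IHD.
  - constructor; auto using ren_ok_shift.
  - rewrite tyren_tysubst1; constructor; now apply IHD.
Qed.

Lemma has_type_tshift G M A :
  has_type G M A -> has_type (map (tyren S) G) (tshift M) (tyren S A).
Proof. intros D; eapply has_type_ren; eauto using ren_ok_tshift. Qed.

Lemma root_ren r M M' q s : root r M M' -> root r (ren q s M) (ren q s M').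
Proof.
  destruct 1; unfold ccase; cbn [ren tyren];
    (* The bound variables that the rules mention explicitly, of index 0 or 1, are fixed by the
       lifted renamings; this must be visible before [constructor] can match a rule. *)
    change (upr s 0) with 0; change (upr q 0) with 0;
    change (upr (upr s) 1) with 1;
    rewrite ?ren_subst1, ?ren_tsubst1, ?ren_sel, ?tyren_sel, ?ren_upr_shift,
      ?ren_swap, ?ren_shift, ?ren_tshift, ?tyren_upr_shift, ?tyren_tysubst1;
    constructor.
Qed.

Lemma fine_root_ren G r M M' q s G' :
  fine_root G r M M' -> ren_ok q s G G' ->
  fine_root G' r (ren q s M) (ren q s M').
Proof.
  intros F E; destruct F as [r M M' I D|r M C A P B Q M' I T D
    |M C A P B Q e M' T D|M C M' T D|M C e M' T D];
    apply (root_ren _ _ _ q s) in D;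
    (* The type [Or A B] of a head becomes [Or] of the renamed [A] and [B], and [Bot] is fixed, so
       the condition on the head persists. *)
    try (eapply has_type_ren in T; [rewrite ?tyren_Or in T|exact E]).
  - now apply FR_beta_eta.
  - now apply FR_varrho_delta.
  - destruct e as [N|i|C'].
    + now apply (FR_varepsilon _ _ _ _ _ _ _ (Eapp (ren q s N))).
    + now apply (FR_varepsilon _ _ _ _ _ _ _ (Eproj i)).
    + now apply (FR_varepsilon _ _ _ _ _ _ _ (Etapp (tyren q C'))).
  - now apply FR_rho.
  - destruct e as [N|i|C'].
    + now apply (FR_epsilon _ _ _ (Eapp (ren q s N))).
    + now apply (FR_epsilon _ _ _ (Eproj i)).
    + now apply (FR_epsilon _ _ _ (Etapp (tyren q C'))).
Qed.

Lemma step_ren R M M' q s : step R M M' -> step R (ren q s M) (ren q s M').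
Proof.
  intros D; revert q s; induction D; intros q s; cbn; try (constructor; now auto).
  eapply S_root; eauto using root_ren.
Qed.

Lemma fine_step_ren R G M M' q s G' :
  fine_step R G M M' -> ren_ok q s G G' ->
  fine_step R G' (ren q s M) (ren q s M').
Proof.
  intros D; revert q s G'; induction D; intros q s G' E; cbn;
    try (constructor; now auto using ren_ok_cons, ren_ok_shift).
  eapply FS_root; eauto using fine_root_ren.
Qed.

Lemma step_incl R R' M M' : incl R R' -> step R M M' -> step R' M M'.
Proof.
  intros E D; induction D; try (constructor; assumption).
  eapply S_root; eauto.
Qed.

Lemma fine_step_incl R R' G M M' :
  incl R R' -> fine_step R G M M' -> fine_step R' G M M'.
Proof.
  intros E D; induction D; try (constructor; assumption).
  eapply FS_root; eauto.
Qed.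

(** * Transitive closures and compatible families of relations *)

Lemma clos_trans_map T T' (f : T -> T') (R : relation T) (R' : relation T') x y :
  (forall a b, R a b -> R' (f a) (f b)) ->
  clos_trans T R x y -> clos_trans T' R' (f x) (f y).
Proof.
  intros E; induction 1; [apply t_step; auto|eapply t_trans; eauto].
Qed.

(** Serves both to enlarge a rule set and to replace each step by a chain. *)
Lemma clos_trans_bind T (R R' : relation T) x y :
  (forall a b, R a b -> clos_trans T R' a b) ->
  clos_trans T R x y -> clos_trans T R' x y.
Proof. intros E; induction 1; [auto|eapply t_trans; eauto]. Qed.

(** The environment index is there for fineness, and closure under renaming for the binders that
    translate an injection. Abstracting over [K] lets single steps and chains share the lifting
    lemma [istep_lift]. *)
Record compatible (K : list ty -> term -> term -> Prop) : Prop := {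
  compatible_lam G A M M' : K (A :: G) M M' -> K G (Lam A M) (Lam A M');
  compatible_app1 G M M' N : K G M M' -> K G (App M N) (App M' N);
  compatible_app2 G M N N' : K G N N' -> K G (App M N) (App M N');
  compatible_pair1 G M M' N : K G M M' -> K G (Pair M N) (Pair M' N);
  compatible_pair2 G M N N' : K G N N' -> K G (Pair M N) (Pair M N');
  compatible_proj G M M' i : K G M M' -> K G (Proj M i) (Proj M' i);
  compatible_tlam G M M' : K (map (tyren S) G) M M' -> K G (TLam M) (TLam M');
  compatible_tapp G M M' B : K G M M' -> K G (TApp M B) (TApp M' B);
  compatible_ren G M M' q r G' :
    K G M M' -> ren_ok q r G G' -> K G' (ren q r M) (ren q r M') }.

Lemma compatible_clos_trans K :
  compatible K -> compatible (fun G => clos_trans term (K G)).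
Proof.
  intros [].
  split; intros;
    (* In each case the conclusion determines the term context through which the whole chain is
       mapped. *)
    match goal with
    | H : clos_trans _ _ ?x ?y |- clos_trans _ _ (Lam ?A _) _ =>
        apply (clos_trans_map _ _ (Lam A) _ _ _ _) with (2 := H)
    | H : clos_trans _ _ ?x ?y |- clos_trans _ _ (App ?x ?N) (App ?y ?N) =>
        apply (clos_trans_map _ _ (fun z => App z N)) with (2 := H)
    | H : clos_trans _ _ ?x ?y |- clos_trans _ _ (App ?N ?x) (App ?N ?y) =>
        apply (clos_trans_map _ _ (App N)) with (2 := H)
    | H : clos_trans _ _ ?x ?y |- clos_trans _ _ (Pair ?x ?N) (Pair ?y ?N) =>
        apply (clos_trans_map _ _ (fun z => Pair z N)) with (2 := H)
    | H : clos_trans _ _ ?x ?y |- clos_trans _ _ (Pair ?N ?x) (Pair ?N ?y) =>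
        apply (clos_trans_map _ _ (Pair N)) with (2 := H)
    | H : clos_trans _ _ ?x ?y |- clos_trans _ _ (Proj _ ?i) _ =>
        apply (clos_trans_map _ _ (fun z => Proj z i)) with (2 := H)
    | H : clos_trans _ _ ?x ?y |- clos_trans _ _ (TLam _) _ =>
        apply (clos_trans_map _ _ TLam) with (2 := H)
    | H : clos_trans _ _ ?x ?y |- clos_trans _ _ (TApp _ ?B) _ =>
        apply (clos_trans_map _ _ (fun z => TApp z B)) with (2 := H)
    | H : clos_trans _ _ ?x ?y |- clos_trans _ _ (ren ?q ?r _) _ =>
        apply (clos_trans_map _ _ (ren q r)) with (2 := H)
    end; eauto.
Qed.

(* A step which is fine provided that H holds.  With H := False this is a plain
   step, with H := True a fine one, and with H saying that the source of a
   reduction is typable, a single chain of such steps yields both the raw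
   reduction and its conditional fineness. *)
Definition cstep (H : Prop) (R : list rule) (G : list ty) (M M' : term) : Prop :=
  step R M M' /\ (H -> fine_step R G M M').

Definition csteps (H : Prop) (R : list rule) (G : list ty) : relation term :=
  clos_trans term (cstep H R G).

Lemma compatible_cstep H R : compatible (cstep H R).
Proof.
  split; intros; match goal with D : cstep _ _ _ _ _ |- _ => destruct D as [D F] end;
    (split; [try (constructor; assumption); now apply step_ren
            |intros h; try (constructor; auto; fail)]).
  eapply fine_step_ren; eauto.
Qed.

Lemma compatible_csteps H R : compatible (csteps H R).
Proof. apply compatible_clos_trans, compatible_cstep. Qed.

Lemma csteps_incl H R R' G M M' :
  incl R R' -> csteps H R G M M' -> csteps H R' G M M'.
Proof.
  intros E; apply clos_trans_bind; intros a b [D F]; apply t_step; split;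
    eauto using step_incl, fine_step_incl.
Qed.

Lemma csteps_steps H R G M M' : csteps H R G M M' -> steps R M M'.
Proof. apply clos_trans_bind; intros a b [D F]; now apply t_step. Qed.

Lemma csteps_fine_steps (H : Prop) R G M M' :
  H -> csteps H R G M M' -> fine_steps R G M M'.
Proof.
  intros h; apply clos_trans_bind; intros a b [D F]; apply t_step; auto.
Qed.

(** * Conditionally fine root steps *)

Lemma cstep_beta_eta H R G r M M' :
  In r R -> In r (beta ++ eta) -> root r M M' -> cstep H R G M M'.
Proof.
  intros I I' D; split;
    [now apply (S_root _ r)|intros _].
  now apply (FS_root _ _ r), FR_beta_eta.
Qed.

(** The typing of the head is asked for only under [H], so that typability of the IPC source, itself
    assumed under [H], can supply it. *)
Lemma cstep_varrho_delta (H : Prop) R G r M C A P B Q M' :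
  In r R -> In r [varrho; delta] -> (H -> has_type G M (Or A B)) ->
  root r (ccase M C A P B Q) M' -> cstep H R G (ccase M C A P B Q) M'.
Proof.
  intros I I' T D; split;
    [now apply (S_root _ r)|intros h].
  apply (FS_root _ _ r), FR_varrho_delta; auto.
Qed.

Lemma cstep_varepsilon (H : Prop) R G M C A P B Q e M' :
  In varepsilon R -> (H -> has_type G M (Or A B)) ->
  root varepsilon (eliminate (ccase M C A P B Q) e) M' ->
  cstep H R G (eliminate (ccase M C A P B Q) e) M'.
Proof.
  intros I T D; split;
    [now apply (S_root _ varepsilon)|intros h].
  apply (FS_root _ _ varepsilon), FR_varepsilon; auto.
Qed.

Lemma cstep_rho (H : Prop) R G M C M' :
  In rho R -> (H -> has_type G M Bot) -> root rho (TApp M C) M' ->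
  cstep H R G (TApp M C) M'.
Proof.
  intros I T D; split;
    [now apply (S_root _ rho)|intros h].
  apply (FS_root _ _ rho), FR_rho; auto.
Qed.

Lemma cstep_epsilon (H : Prop) R G M C e M' :
  In epsilon R -> (H -> has_type G M Bot) ->
  root epsilon (eliminate (TApp M C) e) M' ->
  cstep H R G (eliminate (TApp M C) e) M'.
Proof.
  intros I T D; split;
    [now apply (S_root _ epsilon)|intros h].
  apply (FS_root _ _ epsilon), FR_epsilon; auto.
Qed.

(** The contractum is a variable constrained by an equation, so that a goal may present it in a form
    other than a literal substitution; likewise in the next two lemmas. *)
Lemma cstep_beta_imp H R G A M N M' :
  In beta_imp R -> M' = subst1 N M -> cstep H R G (App (Lam A M) N) M'.
Proof.
  intros I ->.
  apply (cstep_beta_eta _ _ _ beta_imp); cbn; auto; constructor.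
Qed.

Lemma cstep_beta_and H R G i M1 M2 M' :
  In beta_and R -> M' = sel i M1 M2 -> cstep H R G (Proj (Pair M1 M2) i) M'.
Proof.
  intros I ->.
  apply (cstep_beta_eta _ _ _ beta_and); cbn; auto; constructor.
Qed.

Lemma cstep_beta_all H R G M B M' :
  In beta_all R -> M' = tsubst1 B M -> cstep H R G (TApp (TLam M) B) M'.
Proof.
  intros I ->.
  apply (cstep_beta_eta _ _ _ beta_all); cbn; auto; constructor.
Qed.

Lemma cstep_eta_imp H R G A M :
  In eta_imp R -> cstep H R G (Lam A (App (shift M) (Var 0))) M.
Proof.
  intros I.
  apply (cstep_beta_eta _ _ _ eta_imp); cbn; auto 7; constructor.
Qed.

Lemma cstep_eta_and H R G M :
  In eta_and R -> cstep H R G (Pair (Proj M one) (Proj M two)) M.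
Proof.
  intros I.
  apply (cstep_beta_eta _ _ _ eta_and); cbn; auto 7; constructor.
Qed.

Lemma cstep_eta_all H R G M :
  In eta_all R -> cstep H R G (TLam (TApp (tshift M) (Tvar 0))) M.
Proof.
  intros I.
  apply (cstep_beta_eta _ _ _ eta_all); cbn; auto 7; constructor.
Qed.

Lemma csteps_trans H R G M N P :
  csteps H R G M N -> csteps H R G N P -> csteps H R G M P.
Proof. apply t_trans. Qed.

Lemma csteps_cons H R G M N P :
  cstep H R G M N -> csteps H R G N P -> csteps H R G M P.
Proof. intros D; apply t_trans, t_step, D. Qed.

Definition csteps_lam H R := compatible_lam _ (compatible_csteps H R).
Definition csteps_app1 H R := compatible_app1 _ (compatible_csteps H R).
Definition csteps_app2 H R := compatible_app2 _ (compatible_csteps H R).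
Definition csteps_pair1 H R := compatible_pair1 _ (compatible_csteps H R).
Definition csteps_pair2 H R := compatible_pair2 _ (compatible_csteps H R).
Definition csteps_proj H R := compatible_proj _ (compatible_csteps H R).
Definition csteps_tlam H R := compatible_tlam _ (compatible_csteps H R).
Definition csteps_tapp H R := compatible_tapp _ (compatible_csteps H R).

Lemma csteps_pair H R G M M' N N' :
  csteps H R G M M' -> csteps H R G N N' ->
  csteps H R G (Pair M N) (Pair M' N').
Proof.
  intros D D'; apply t_trans with (Pair M' N);
    [now apply csteps_pair1|now apply csteps_pair2].
Qed.

Lemma csteps_branches H R G M C A P P' B Q Q' :
  csteps H R (A :: G) P P' -> csteps H R (B :: G) Q Q' ->
  csteps H R G (ccase M C A P B Q) (ccase M C A P' B Q').
Proof. intros D D'; apply csteps_app2, csteps_pair; now apply csteps_lam. Qed.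

(** * Simulating [varepsilon], [epsilon] and [delta] by [varrho] and [rho] *)

Lemma fine_root_root G r M M' : fine_root G r M M' -> root r M M'.
Proof. now destruct 1. Qed.

Lemma fine_delta_head G M C A P B Q M' :
  fine_root G delta (ccase M C A P B Q) M' -> has_type G M (Or A B).
Proof.
  intros F; inversion F; subst; [|assumption].
  match goal with I : In delta (beta ++ eta) |- _ => cbn in I end.
  intuition discriminate.
Qed.

Lemma fine_varepsilon_head G M C A P B Q e M' :
  fine_root G varepsilon (eliminate (ccase M C A P B Q) e) M' ->
  has_type G M (Or A B).
Proof.
  (* The redex is not in constructor form while [e] is abstract; it is generalized, and the equation
     is solved once both eliminators are known to have the same shape. *)
  remember varepsilon as r eqn:Er.
  remember (eliminate _ _) as L eqn:EL; intros F.
  destruct F as [r L L' I D|r N C' A' P' B' Q' L' I T D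
    |N C' A' P' B' Q' e' L' T D|N C' L' T D|N C' e' L' T D];
    try discriminate.
  - subst; cbn in I; intuition discriminate.
  - subst; cbn in I; intuition discriminate.
  - destruct e, e'; try discriminate; injection EL; intros; now subst.
Qed.

Lemma fine_epsilon_head G M C e M' :
  fine_root G epsilon (eliminate (TApp M C) e) M' -> has_type G M Bot.
Proof.
  remember epsilon as r eqn:Er.
  remember (eliminate _ _) as L eqn:EL; intros F.
  destruct F as [r L L' I D|r N C' A' P' B' Q' L' I T D
    |N C' A' P' B' Q' e' L' T D|N C' L' T D|N C' e' L' T D];
    try discriminate.
  - subst; cbn in I; intuition discriminate.
  - subst; cbn in I; intuition discriminate.
  - destruct e, e'; try discriminate; injection EL; intros; now subst.
Qed.

(** Computes the beta-contraction following [varrho] at an implication: the head was shifted only to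
    pass below the new binder, so it comes back unchanged and the branches alone are substituted. *)
Lemma subst1_ccase N M C A P B Q :
  subst1 N (ccase (shift M) C A P B Q)
  = let s := scons (Var 0) (fun n => shift (scons N Var n)) in
    ccase M C A (subst Tvar s P) B (subst Tvar s Q).
Proof.
  unfold subst1 at 1; cbn.
  change (subst Tvar (scons N Var) (shift M)) with (subst1 N (shift M)).
  now rewrite subst1_shift, !(tysubst_id Tvar).
Qed.

(** The analogue for [varrho] at a quantifier, where [C] is instantiated as well. *)
Lemma tsubst1_ccase E M C A P B Q :
  tsubst1 E (ccase (tshift M) C (tyren S A) P (tyren S B) Q)
  = let s := scons (Var 0) (fun n => shift (Var n)) in
    ccase M (tysubst1 E C) A (subst (scons E Tvar) s P)
      B (subst (scons E Tvar) s Q).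
Proof.
  unfold tsubst1 at 1; cbn.
  change (subst (scons E Tvar) Var (tshift M)) with (tsubst1 E (tshift M)).
  change (tysubst (scons E Tvar)) with (tysubst1 E).
  now rewrite tsubst1_tshift, !tysubst1_shift.
Qed.

Definition varrho_rules : list rule := beta ++ eta ++ [varrho; rho].

Lemma varepsilon_by_varrho (H : Prop) G M C A P B Q e M' :
  (H -> has_type G M (Or A B)) ->
  root varepsilon (eliminate (ccase M C A P B Q) e) M' ->
  csteps H varrho_rules G (eliminate (ccase M C A P B Q) e) M'.
Proof.
  intros T D; destruct e as [N|i|E]; inversion D; subst; cbn.
  - eapply t_trans.
    + apply csteps_app1, t_step.
      eapply (cstep_varrho_delta _ _ _ varrho); cbn; auto 20; constructor.
    + apply t_step, cstep_beta_imp; [cbn; auto 20|].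
      rewrite subst1_ccase; cbn; rewrite !subst_ren.
      (* Inserting an index for z into [P] or [Q] and then substituting [N] for z is the
         identity. *)
      f_equal; f_equal; f_equal; f_equal; symmetry; apply subst_id; auto; index_cases.
  - eapply t_trans.
    + apply csteps_proj, t_step.
      eapply (cstep_varrho_delta _ _ _ varrho); cbn; auto 20; constructor.
    + apply t_step, cstep_beta_and; [cbn; auto 20|].
      now destruct i.
  - eapply t_trans.
    + apply csteps_tapp, t_step.
      eapply (cstep_varrho_delta _ _ _ varrho); cbn; auto 20; constructor.
    + apply t_step, cstep_beta_all; [cbn; auto 20|].
      rewrite tsubst1_ccase; cbn; unfold tshift; rewrite !subst_ren.
      f_equal; f_equal; f_equal; f_equal; symmetry; apply subst_id; auto; index_cases.
Qed.

Lemma epsilon_by_rho (H : Prop) G M C e M' :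
  (H -> has_type G M Bot) ->
  root epsilon (eliminate (TApp M C) e) M' ->
  csteps H varrho_rules G (eliminate (TApp M C) e) M'.
Proof.
  intros T D; destruct e as [N|i|E]; inversion D; subst; cbn.
  - eapply t_trans.
    + apply csteps_app1, t_step, cstep_rho; cbn; auto 20; constructor.
    + apply t_step, cstep_beta_imp; [cbn; auto 20|].
      change (TApp M C2 = TApp (subst1 N (shift M)) (tysubst Tvar C2)).
      now rewrite subst1_shift, tysubst_id.
  - eapply t_trans.
    + apply csteps_proj, t_step, cstep_rho; cbn; auto 20; constructor.
    + apply t_step, cstep_beta_and; [cbn; auto 20|].
      now destruct i.
  - eapply t_trans.
    + apply csteps_tapp, t_step, cstep_rho; cbn; auto 20; constructor.
    + apply t_step, cstep_beta_all; [cbn; auto 20|].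
      change (TApp M (tysubst1 E C') = TApp (tsubst1 E (tshift M)) (tysubst1 E C')).
      now rewrite tsubst1_tshift.
Qed.

Lemma delta_by_varrho (H : Prop) G M C A P B Q M' :
  (H -> has_type G M (Or A B)) ->
  root delta (ccase M C A P B Q) M' ->
  csteps H varrho_rules G (ccase M C A P B Q) M'.
Proof.
  intros T D.
  inversion D; subst;
    (eapply csteps_cons;
     [eapply (cstep_varrho_delta _ _ _ varrho);
      [cbn; auto 20|cbn; auto|exact T|constructor]|]).
  - apply csteps_lam, csteps_branches; cbn; rewrite tyren_id by reflexivity;
      apply t_step, cstep_beta_imp; cbn; auto 20;
      (* The outer z has index 1 below x; substituting it for the inner binder sends 0 to 1, 1 to 0
         and fixes all other indices, which is [swap]. *)
      unfold subst1; rewrite subst_ren; symmetry; apply subst_as_ren; auto;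
      intros [|[|n]]; reflexivity.
  - apply csteps_pair; apply csteps_branches; apply t_step, cstep_beta_and;
      cbn; auto 20.
  - apply csteps_tlam, csteps_branches;
      apply t_step, cstep_beta_all; cbn; auto 20;
      unfold tsubst1; rewrite subst_ren; symmetry; apply subst_id; auto; index_cases.
Qed.

Definition varepsilon_rules : list rule :=
  beta ++ eta ++ [varepsilon; epsilon; delta].

(** The simulating chains are fine only if the head is typed; under [H] this typing is read off from
    the fineness of the given step. *)
Lemma root_simulation (H : Prop) G r M M' :
  In r varepsilon_rules -> root r M M' -> (H -> fine_root G r M M') ->
  csteps H varrho_rules G M M'.
Proof.
  intros I D F.
  assert (J : In r (beta ++ eta) \/ In r [varepsilon; epsilon; delta]).
  { apply in_app_or; now rewrite <- app_assoc. }
  destruct J as [J|J].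
  - apply t_step, (cstep_beta_eta _ _ _ r); auto.
    unfold varrho_rules; rewrite app_assoc; apply in_or_app; auto.
  - destruct J as [<-|[<-|[<-|[]]]]; inversion D; subst.
    + apply (varepsilon_by_varrho H G M0 (Imp C1 C2) A P B Q (Eapp N)); auto.
      intros h; eapply (fine_varepsilon_head _ _ _ _ _ _ _ (Eapp N)); eauto.
    + apply (varepsilon_by_varrho H G M0 (And C1 C2) A P B Q (Eproj i)); auto.
      intros h; eapply (fine_varepsilon_head _ _ _ _ _ _ _ (Eproj i)); eauto.
    + apply (varepsilon_by_varrho H G M0 (All C') A P B Q (Etapp C'')); auto.
      intros h; eapply (fine_varepsilon_head _ _ _ _ _ _ _ (Etapp C'')); eauto.
    + apply (epsilon_by_rho H G M0 (Imp C1 C2) (Eapp N)); auto.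
      intros h; eapply (fine_epsilon_head _ _ _ (Eapp N)); eauto.
    + apply (epsilon_by_rho H G M0 (And C1 C2) (Eproj i)); auto.
      intros h; eapply (fine_epsilon_head _ _ _ (Eproj i)); eauto.
    + apply (epsilon_by_rho H G M0 (All C') (Etapp C'')); auto.
      intros h; eapply (fine_epsilon_head _ _ _ (Etapp C'')); eauto.
    + apply delta_by_varrho; auto; intros h; eapply fine_delta_head; eauto.
    + apply delta_by_varrho; auto; intros h; eapply fine_delta_head; eauto.
    + apply delta_by_varrho; auto; intros h; eapply fine_delta_head; eauto.
Qed.

Ltac congruence_steps :=
  auto using csteps_lam, csteps_app1, csteps_app2, csteps_pair1, csteps_pair2,
    csteps_proj, csteps_tlam, csteps_tapp.

Lemma steps_simulation M M' :
  steps varepsilon_rules M M' -> steps varrho_rules M M'.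
Proof.
  apply clos_trans_bind; intros a b D; apply (csteps_steps False _ []).
  (* A raw step has no environment: any one will do, but it has to vary because binders extend
     it. *)
  generalize (@nil ty).
  induction D; intros G; congruence_steps.
  eapply root_simulation; eauto; easy.
Qed.

Lemma fine_steps_simulation G M M' :
  fine_steps varepsilon_rules G M M' -> fine_steps varrho_rules G M M'.
Proof.
  apply clos_trans_bind; intros a b D; apply (csteps_fine_steps True); [easy|].
  induction D; congruence_steps.
  eapply root_simulation; eauto using fine_root_root.
Qed.

(** * The translation commutes with substitution and preserves typing *)

Lemma rp_iren r M : rp (iren r M) = ren idr r (rp M).
Proof.
  (* Below the type binder of an injection the renaming of type indices is [upr idr], which is still
     the identity. *)
  assert (E : forall n, upr idr n = n) by index_cases.
  revert r; induction M; intros r; cbn;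
    rewrite ?IHM, ?IHM1, ?IHM2, ?IHM3, ?ren_ren, ?(tyren_id (upr idr)),
      ?(tyren_id idr) by auto; reflexivity.
Qed.

Lemma rp_isubst s M : rp (isubst s M) = subst Tvar (fun n => rp (s n)) (rp M).
Proof.
  assert (E : forall n, tyup Tvar n = Tvar n) by index_cases.
  assert (up : forall s M, subst Tvar (fun n => rp (iup s n)) M
                 = subst Tvar (scons (Var 0) (fun n => shift (rp (s n)))) M).
  { intros s' N; apply subst_ext; auto; index_cases; apply rp_iren. }
  revert s; induction M; intros s; cbn;
    rewrite ?IHM, ?IHM1, ?IHM2, ?IHM3, ?up, ?(tysubst_id Tvar),
      ?(tysubst_id (tyup Tvar)) by auto; try reflexivity.
  (* The injection is left: its subterm lies below X and w, so the substitution was lifted over both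
     binders. *)
  rewrite ren_subst, subst_ren; do 3 f_equal; apply subst_ext; auto.
  intros n; cbn; unfold shift, tshift; now rewrite ren_ren.
Qed.

Lemma rp_isubst1 N M : rp (isubst1 N M) = subst1 (rp N) (rp M).
Proof.
  unfold isubst1; rewrite rp_isubst; apply subst_ext; auto; index_cases.
Qed.

Lemma rp_sel i M N : rp (sel i M N) = sel i (rp M) (rp N).
Proof. now destruct i. Qed.

Lemma rpty_sel i A B : rpty (sel i A B) = sel i (rpty A) (rpty B).
Proof. now destruct i. Qed.

Lemma rp_has_type G M A :
  ihas_type G M A -> has_type (rpctx G) (rp M) (rpty A).
Proof.
  induction 1; cbn.
  - constructor; unfold rpctx; rewrite nth_error_map; now rewrite H.
  - now constructor.
  - econstructor; eauto.
  - now constructor.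
  - rewrite rpty_sel; now constructor.
  - constructor; constructor.
    (* Writing the domain as a shifted [sel] treats both injections at once: the projection of w has
       the arrow type chosen by the same [sel]. *)
    eapply T_App with (A := tyren S (sel i (rpty A) (rpty B))).
    + replace (Imp (tyren S (sel _ _ _)) _)
        with (sel i (Imp (tyren S (rpty A)) (Tvar 0))
                    (Imp (tyren S (rpty B)) (Tvar 0)))
        by now destruct i.
      constructor; now constructor.
    + rewrite rpty_sel in IHihas_type.
      eapply has_type_ren; eauto using ren_ok_weaken.
  - eapply T_App with (A := And (Imp (rpty A) (rpty C)) (Imp (rpty B) (rpty C))).
    + rewrite <- tysubst1_Or; now constructor.
    + constructor; now constructor.
  - change (rpty A) with (tysubst1 (rpty A) (Tvar 0)) at 2; now constructor.
Qed.

(** Inverting the typing of the case gives its scrutinee a disjunctive type, which is what fineness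
    of [varepsilon] and [delta] at the translation asks for. *)
Lemma itypable_case_head (H : Prop) G M A P B Q C :
  (H -> itypable G (ICase M A P B Q C)) ->
  H -> has_type (rpctx G) (rp M) (Or (rpty A) (rpty B)).
Proof.
  intros T h; destruct (T h) as [D TD]; inversion TD; subst.
  now apply (rp_has_type G M (IOr A B)).
Qed.

Lemma itypable_abort_head (H : Prop) G M A :
  (H -> itypable G (IAbort M A)) -> H -> has_type (rpctx G) (rp M) Bot.
Proof.
  intros T h; destruct (T h) as [D TD]; inversion TD; subst.
  now apply (rp_has_type G M IBot).
Qed.

(** * From root reductions to the compatible closure *)

Ltac subterm_typable :=
  let h := fresh in let T := fresh in let D := fresh in
  intros h;
  match goal with
  | E : ?H -> itypable _ _, h : ?H |- _ => destruct (E h) as [T D]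
  end;
  inversion D; subst; eexists; eassumption.

(** Each constructor of IPC translates to a context composed of constructors of F, so the closure
    conditions on [K] are applied in turn. Typability descends to subterms and so reaches the
    contracted redex. *)
Lemma istep_lift (H : Prop) K R :
  compatible K ->
  (forall r G M M', In r R -> iroot r M M' -> (H -> itypable G M) ->
     K (rpctx G) (rp M) (rp M')) ->
  forall M M' G, istep R M M' -> (H -> itypable G M) ->
    K (rpctx G) (rp M) (rp M').
Proof.
  intros [Klam Kapp1 Kapp2 Kpair1 Kpair2 Kproj Ktlam Ktapp Kren] Root M M' G D.
  revert G; induction D; intros G T; cbn.
  - eauto.
  - apply Klam, (IHD (A :: G)); subterm_typable.
  - apply Kapp1, IHD; subterm_typable.
  - apply Kapp2, IHD; subterm_typable.
  - apply Kpair1, IHD; subterm_typable.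
  - apply Kpair2, IHD; subterm_typable.
  - apply Kproj, IHD; subterm_typable.
  (* The subterm of an injection is translated below X and w, so its reduction is renamed into the
     environment shifted for X and extended by w. *)
  - apply Ktlam, Klam, Kapp2.
    apply Kren with (rpctx G); [apply IHD; subterm_typable|apply ren_ok_weaken].
  - apply Kapp1, Ktapp, IHD; subterm_typable.
  - apply Kapp2, Kpair1, Klam, (IHD (A :: G)); subterm_typable.
  - apply Kapp2, Kpair2, Klam, (IHD (B :: G)); subterm_typable.
  - apply Ktapp, IHD; subterm_typable.
Qed.

(** * Translating the root reductions of IPC *)

Lemma root_imp_and (H : Prop) r r' G M M' :
  In (r, r') [(ibeta_imp, beta_imp); (ieta_imp, eta_imp);
              (ibeta_and, beta_and); (ieta_and, eta_and)] ->
  iroot r M M' -> cstep H [r'] G (rp M) (rp M').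
Proof.
  intros I D; destruct I as [E|[E|[E|[E|[]]]]]; injection E as <- <-;
    inversion D; subst; cbn.
  - apply cstep_beta_imp; [now left|apply rp_isubst1].
  - rewrite rp_iren; apply cstep_eta_imp; now left.
  - apply cstep_beta_and; [now left|apply rp_sel].
  - apply cstep_eta_and; now left.
Qed.

(** Four beta steps: X is instantiated by the translation of [C], w by the pair of branches, the
    pair is projected, and the chosen branch receives the injected term. *)
Lemma root_beta_or (H : Prop) G M M' :
  iroot ibeta_or M M' -> csteps H beta G (rp M) (rp M').
Proof.
  intros D; inversion D as [| |i N A1 A2 P1 P2 C| | | | | | | | | | |]; subst; cbn.
  rewrite rp_isubst1, rp_sel.
  apply csteps_cons with
    (App (Lam (And (Imp (rpty A1) (rpty C)) (Imp (rpty A2) (rpty C)))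
            (App (Proj (Var 0) i) (shift (rp N))))
       (Pair (Lam (rpty A1) (rp P1)) (Lam (rpty A2) (rp P2)))).
  { apply compatible_app1; [apply compatible_cstep|].
    apply cstep_beta_all; [cbn; auto|].
    unfold tsubst1; cbn.
    change (tysubst (scons (rpty C) Tvar)) with (tysubst1 (rpty C)).
    rewrite !tysubst1_shift, subst_ren; do 2 f_equal.
    (* Instantiating X cancels the type shift of the injected term; the shift past w remains. *)
    symmetry; now apply subst_as_ren. }
  apply csteps_cons with
    (App (Proj (Pair (Lam (rpty A1) (rp P1)) (Lam (rpty A2) (rp P2))) i) (rp N)).
  { apply cstep_beta_imp; [cbn; auto|].
    unfold subst1; cbn [subst scons]; f_equal; symmetry; apply subst1_shift. }
  apply csteps_cons with (App (sel i (Lam (rpty A1) (rp P1))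
                                     (Lam (rpty A2) (rp P2))) (rp N)).
  { apply compatible_app1; [apply compatible_cstep|].
    apply cstep_beta_and; cbn; auto. }
  destruct i; apply t_step, cstep_beta_imp; cbn; auto.
Qed.

(** A disjunction translates to a quantified implication and both branches are injections, so
    [delta] first moves X and then w outside the case. What is left is an iterated eta-expansion of
    the head, contracted in the order branches, pair, w, X. *)
Lemma root_eta_or (H : Prop) G M M' :
  iroot ieta_or M M' -> (H -> itypable G M) ->
  csteps H (eta ++ [delta]) (rpctx G) (rp M) (rp M').
Proof.
  intros D T; inversion D as [| | | | | | | | | | | | |N A B]; subst.
  assert (TN := itypable_case_head _ _ _ _ _ _ _ _ T).
  eapply csteps_cons.
  { eapply (cstep_varrho_delta _ _ _ delta);
      [cbn; auto|cbn; auto|exact TN|constructor]. }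
  apply csteps_trans with (TLam (TApp (tshift (rp M')) (Tvar 0)));
    [|apply t_step, cstep_eta_all; cbn; auto].
  apply csteps_tlam.
  eapply csteps_cons.
  { eapply (cstep_varrho_delta _ _ _ delta);
      [cbn; auto|cbn; auto| |constructor].
    intros h; rewrite <- tyren_Or; apply has_type_tshift; auto. }
  apply csteps_trans with
    (Lam (And (Imp (tyren S (rpty A)) (Tvar 0)) (Imp (tyren S (rpty B)) (Tvar 0)))
       (App (shift (TApp (tshift (rp M')) (Tvar 0))) (Var 0)));
    [|apply t_step, cstep_eta_imp; cbn; auto].
  apply csteps_lam, csteps_app2.
  apply csteps_trans with (Pair (Proj (Var 0) one) (Proj (Var 0) two)).
  - apply csteps_pair; apply t_step.
    (* After [swap] the branch applies a projection of w to the variable x bound last, which is an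
       eta-redex. *)
    + apply (cstep_eta_imp _ _ _ _ (Proj (Var 0) one)); cbn; auto.
    + apply (cstep_eta_imp _ _ _ _ (Proj (Var 0) two)); cbn; auto.
  - apply t_step, cstep_eta_and; cbn; auto.
Qed.

(** Each rule takes one [varepsilon] step, save [ipi_or]: there the outer case is a type application
    followed by an application to the pair of branches, each of which takes one. *)
Lemma root_pi (H : Prop) r G M M' :
  In r [ipi_imp; ipi_and; ipi_or; ipi_bot] -> iroot r M M' ->
  (H -> itypable G M) ->
  csteps H [varepsilon] (rpctx G) (rp M) (rp M').
Proof.
  intros I D T; destruct I as [<-|[<-|[<-|[<-|[]]]]]; inversion D; subst.
  - assert (TN : H -> itypable G (ICase M0 A P B Q (IImp C D0)))
      by subterm_typable.
    assert (TM := itypable_case_head _ _ _ _ _ _ _ _ TN); cbn; rewrite !rp_iren.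
    apply t_step, (cstep_varepsilon H _ _ _ (Imp _ _) _ _ _ _ (Eapp _));
      cbn; auto; constructor.
  - assert (TN : H -> itypable G (ICase M0 A P B Q (IAnd C1 C2)))
      by subterm_typable.
    assert (TM := itypable_case_head _ _ _ _ _ _ _ _ TN); cbn; rewrite rpty_sel.
    apply t_step, (cstep_varepsilon H _ _ _ (And _ _) _ _ _ _ (Eproj _));
      cbn; auto; constructor.
  - assert (TN : H -> itypable G (ICase M0 A' P' B' Q' (IOr C D0)))
      by subterm_typable.
    assert (TM := itypable_case_head _ _ _ _ _ _ _ _ TN); cbn; rewrite !rp_iren.
    eapply csteps_cons.
    { apply compatible_app1; [apply compatible_cstep|].
      apply (cstep_varepsilon H _ _ _ (Or _ _) _ _ _ _ (Etapp _));
        [cbn; auto|exact TM|constructor]. }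
    rewrite tysubst1_Or.
    pose (branches := Pair (Lam (rpty C) (rp P)) (Lam (rpty D0) (rp Q))).
    assert (F := cstep_varepsilon H [varepsilon] _ _ _ _ _ _ _ (Eapp branches) _
                   (or_introl eq_refl) TM
                   (R_varepsilon_imp _ (And (Imp (rpty C) (rpty E))
                                            (Imp (rpty D0) (rpty E)))
                      (rpty E) _ (TApp (rp P') (rpty E))
                      _ (TApp (rp Q') (rpty E)) branches)).
    (* Shifting the pair of branches renames term indices only, hence leaves the type annotations
       unchanged. *)
    unfold shift in F; cbn in F; rewrite !tyren_id in F by easy.
    apply t_step, F.
  - assert (TN : H -> itypable G (ICase M0 A P B Q IBot)) by subterm_typable.
    assert (TM := itypable_case_head _ _ _ _ _ _ _ _ TN); cbn.
    apply t_step, (cstep_varepsilon H _ _ _ Bot _ _ _ _ (Etapp _));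
      [cbn; auto|exact TM|constructor].
Qed.

(** As for the pi-rules, only [ivarpi_or] takes two steps, one for each elimination in the
    translated case. *)
Lemma root_varpi (H : Prop) r G M M' :
  In r [ivarpi_imp; ivarpi_and; ivarpi_or; ivarpi_bot] -> iroot r M M' ->
  (H -> itypable G M) ->
  csteps H [epsilon] (rpctx G) (rp M) (rp M').
Proof.
  intros I D T; destruct I as [<-|[<-|[<-|[<-|[]]]]]; inversion D; subst.
  - assert (TN : H -> itypable G (IAbort M0 (IImp C D0))) by subterm_typable.
    assert (TM := itypable_abort_head _ _ _ _ TN).
    apply t_step, (cstep_epsilon H _ _ _ (Imp _ _) (Eapp _));
      [cbn; auto|exact TM|constructor].
  - assert (TN : H -> itypable G (IAbort M0 (IAnd C1 C2))) by subterm_typable.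
    assert (TM := itypable_abort_head _ _ _ _ TN); cbn; rewrite rpty_sel.
    apply t_step, (cstep_epsilon H _ _ _ (And _ _) (Eproj _));
      [cbn; auto|exact TM|constructor].
  - assert (TN : H -> itypable G (IAbort M0 (IOr C D0))) by subterm_typable.
    assert (TM := itypable_abort_head _ _ _ _ TN); cbn.
    eapply csteps_cons.
    { apply compatible_app1; [apply compatible_cstep|].
      apply (cstep_epsilon H _ _ _ (Or _ _) (Etapp _));
        [cbn; auto|exact TM|constructor]. }
    rewrite tysubst1_Or.
    apply t_step, (cstep_epsilon H _ _ _ (Imp _ _) (Eapp _));
      [cbn; auto|exact TM|constructor].
  - assert (TN : H -> itypable G (IAbort M0 IBot)) by subterm_typable.
    assert (TM := itypable_abort_head _ _ _ _ TN).
    apply t_step, (cstep_epsilon H _ _ _ Bot (Etapp _));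
      [cbn; auto|exact TM|constructor].
Qed.

(** * Assembling the raw and the fine reductions *)

Lemma istep_rule R M M' : istep R M M' -> exists r, In r R /\ istep [r] M M'.
Proof.
  induction 1; try (destruct IHistep as [r [I D]]; exists r; now split; [|constructor]).
  exists r; split; [assumption|apply (Is_root _ r); [now left|assumption]].
Qed.

(** [H := False] makes the premise vacuous and yields the raw reduction; [H := True] yields fineness
    in each environment that types the source. *)
Lemma csteps_steps_fine R M1 M2 :
  (forall (H : Prop) G, (H -> itypable G M1) ->
     csteps H R (rpctx G) (rp M1) (rp M2)) ->
  steps R (rp M1) (rp M2) /\
  (forall G, itypable G M1 -> fine_steps R (rpctx G) (rp M1) (rp M2)).
Proof.
  intros E; split.
  - now apply (csteps_steps False _ (rpctx [])), E.
  - intros G T; now apply (csteps_fine_steps True), E.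
Qed.

Lemma istep_root_csteps (P : irule -> Prop) R M1 M2 :
  (forall (H : Prop) r G M M', P r -> iroot r M M' ->
     (H -> itypable G M) -> csteps H R (rpctx G) (rp M) (rp M')) ->
  forall r (H : Prop) G, P r -> istep [r] M1 M2 -> (H -> itypable G M1) ->
    csteps H R (rpctx G) (rp M1) (rp M2).
Proof.
  intros Root r H G Pr D T.
  apply (istep_lift H (csteps H R) [r]); auto using compatible_csteps.
  intros r' G' M M' [<-|[]]; now apply Root.
Qed.

Theorem theorem1 (M1 M2 : iterm) :
  (istep irules M1 M2 ->
     steps (beta ++ eta ++ [varepsilon; epsilon; delta]) (rp M1) (rp M2) /\
     steps (beta ++ eta ++ [varrho; rho]) (rp M1) (rp M2) /\
     (forall G : list ity, itypable G M1 ->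
        fine_steps (beta ++ eta ++ [varepsilon; epsilon; delta])
          (rpctx G) (rp M1) (rp M2) /\
        fine_steps (beta ++ eta ++ [varrho; rho])
          (rpctx G) (rp M1) (rp M2))) /\
  (forall (r : irule) (r' : rule),
     In (r, r') [(ibeta_imp, beta_imp); (ieta_imp, eta_imp);
                 (ibeta_and, beta_and); (ieta_and, eta_and)] ->
     istep [r] M1 M2 ->
     step [r'] (rp M1) (rp M2) /\
     (forall G : list ity, itypable G M1 ->
        fine_step [r'] (rpctx G) (rp M1) (rp M2))) /\
  (istep [ibeta_or] M1 M2 ->
     steps beta (rp M1) (rp M2) /\
     (forall G : list ity, itypable G M1 ->
        fine_steps beta (rpctx G) (rp M1) (rp M2))) /\
  (istep [ieta_or] M1 M2 ->
     steps (eta ++ [delta]) (rp M1) (rp M2) /\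
     (forall G : list ity, itypable G M1 ->
        fine_steps (eta ++ [delta]) (rpctx G) (rp M1) (rp M2))) /\
  (forall r : irule,
     In r [ipi_imp; ipi_and; ipi_or; ipi_bot] ->
     istep [r] M1 M2 ->
     steps [varepsilon] (rp M1) (rp M2) /\
     (forall G : list ity, itypable G M1 ->
        fine_steps [varepsilon] (rpctx G) (rp M1) (rp M2))) /\
  (forall r : irule,
     In r [ivarpi_imp; ivarpi_and; ivarpi_or; ivarpi_bot] ->
     istep [r] M1 M2 ->
     steps [epsilon] (rp M1) (rp M2) /\
     (forall G : list ity, itypable G M1 ->
        fine_steps [epsilon] (rpctx G) (rp M1) (rp M2))).

Proof.
  (* A single step is claimed for these rules, so the lifting is done with [cstep] rather than its
     transitive closure. *)
  assert (Imp_and : forall r r' (H : Prop) G,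
    In (r, r') [(ibeta_imp, beta_imp); (ieta_imp, eta_imp);
                (ibeta_and, beta_and); (ieta_and, eta_and)] ->
    istep [r] M1 M2 -> (H -> itypable G M1) ->
    cstep H [r'] (rpctx G) (rp M1) (rp M2)).
  { intros r r' H G I D T.
    apply (istep_lift H (cstep H [r']) [r]); auto using compatible_cstep.
    intros s G' M M' [<-|[]] D' _; now apply (root_imp_and H r). }
  assert (Beta_or := istep_root_csteps (eq ibeta_or) beta M1 M2
    ltac:(intros H r G M M' <- D _; now apply root_beta_or)).
  assert (Eta_or := istep_root_csteps (eq ieta_or) (eta ++ [delta]) M1 M2
    ltac:(intros H r G M M' <-; apply root_eta_or)).
  assert (Pi := istep_root_csteps _ [varepsilon] M1 M2
    (fun H r G M M' => root_pi H r G M M')).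
  assert (Varpi := istep_root_csteps _ [epsilon] M1 M2
    (fun H r G M M' => root_varpi H r G M M')).
  split; [|split; [intros r r' I D; split|split; [|split; [|split]]]].
  - intros D.
    assert (All_rules : steps varepsilon_rules (rp M1) (rp M2) /\
      (forall G, itypable G M1 ->
         fine_steps varepsilon_rules (rpctx G) (rp M1) (rp M2))).
    { apply csteps_steps_fine; intros H G T.
      (* A step of the union uses one rule, so the sharper result for the group of that rule
         applies, and its rule set is then enlarged. *)
      destruct (istep_rule _ _ _ D) as [r [I Dr]].
      assert (J : (exists r', In r' (beta ++ eta) /\
                    In (r, r') [(ibeta_imp, beta_imp); (ieta_imp, eta_imp);
                                (ibeta_and, beta_and); (ieta_and, eta_and)]) \/
        ibeta_or = r \/ ieta_or = r \/
        In r [ipi_imp; ipi_and; ipi_or; ipi_bot] \/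
        In r [ivarpi_imp; ivarpi_and; ivarpi_or; ivarpi_bot]).
      { destruct r; try (cbn; now auto 10); left;
          [exists beta_imp|exists beta_and|exists eta_imp|exists eta_and];
          cbn; auto 10. }
      destruct J as [[r' [I' J]]|[J|[J|[J|J]]]].
      - apply csteps_incl with [r'].
        + intros s [<-|[]]; unfold varepsilon_rules; rewrite app_assoc.
          now apply in_or_app; left.
        + now apply t_step, (Imp_and r).
      - apply csteps_incl with beta; [|now apply (Beta_or r)].
        now apply incl_appl.
      - apply csteps_incl with (eta ++ [delta]); [|now apply (Eta_or r)].
        unfold incl; cbn; intuition.
      - apply csteps_incl with [varepsilon]; [|now apply (Pi r)].
        unfold incl; cbn; intuition.
      - apply csteps_incl with [epsilon]; [|now apply (Varpi r)].
        unfold incl; cbn; intuition. }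
    destruct All_rules as [S F]; repeat split; auto.
    + now apply steps_simulation.
    + now apply fine_steps_simulation, F.
  - now apply (Imp_and r r' False []).
  - intros G T; now apply (Imp_and r r' True).
  - intros D; apply csteps_steps_fine; intros; now apply (Beta_or ibeta_or).
  - intros D; apply csteps_steps_fine; intros; now apply (Eta_or ieta_or).
  - intros r I D; apply csteps_steps_fine; intros; now apply (Pi r).
  - intros r I D; apply csteps_steps_fine; intros; now apply (Varpi r).
Qed.
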